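(* Let $G$ be a finite group with $h(G)$ conjugacy classes. Then $Deg(G)=|G|(h(G)+1)$ if and only if $G$ is an abelian group.
   Context: $o(x)$ denotes the order of an element $x$. For a finite group $G$, the $LCM$-graph $\Gamma(G)$ is the undirected graph with vertex set $G$ in which $x$ and $y$ (possibly equal) are connected whenever $o(xy)\mid \mathrm{lcm}(o(x),o(y))$. Degrees count loops twice; since $o(x^2)\mid o(x)$, every vertex carries a loop, so $deg(x)=1+|\{y\in G: o(xy)\mid \mathrm{lcm}(o(x),o(y))\}|$. $Deg(G)=\sum_{g\in G}deg(g)$. *)

(* Defs.v *)
From HB Require Import structures.
From mathcomp Require Import all_boot all_fingroup.

Set Implicit Arguments.
Unset Strict Implicit.
Unset Printing Implicit Defensive.

Local Open Scope group_scope.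

(* Adjacency in the LCM-graph; [#[x]] is the order of [x]. The vertex set [G]
   enters only in the degrees below. The relation is symmetric because [x * y]
   and [y * x] are conjugate, so reading the undirected graph as a relation on
   ordered pairs loses nothing. *)
Definition lcm_adj (gT : finGroupType) (x y : gT) : bool :=
  #[x * y] %| lcmn #[x] #[y].

(* A loop counts twice: once among the neighbours of [x], and once more through
   the boolean [lcm_adj x x] coerced to [nat]. *)
Definition lcm_deg (gT : finGroupType) (G : {group gT}) (x : gT) : nat :=
  (#|[set y in G | lcm_adj x y]| + lcm_adj x x)%N.

Definition lcm_Deg (gT : finGroupType) (G : {group gT}) : nat :=
  (\sum_(g in G) lcm_deg G g)%N.

Lemma lcm_adjC (gT : finGroupType) (x y : gT) : lcm_adj x y = lcm_adj y x.
Proof. by rewrite /lcm_adj lcmnC -(orderJ (x * y) x) conjgE mulgA mulKg. Qed.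

Lemma lcm_adjxx (gT : finGroupType) (x : gT) : lcm_adj x x.
Proof.
by apply: dvdn_trans (dvdn_lcml _ _); rewrite cardSg // cycle_subG groupM ?cycle_id.
Qed.

Lemma lcm_degE (gT : finGroupType) (G : {group gT}) (x : gT) :
  lcm_deg G x = (1 + #|[set y in G | #[x * y] %| lcmn #[x] #[y]]|)%N.
Proof. by rewrite /lcm_deg lcm_adjxx addnC. Qed.

(* Main.v *)
Require Import Defs.
From mathcomp Require Import all_boot all_fingroup.
From mathcomp Require Import ssralg all_solvable.

(** Commuting elements are always adjacent, because [(x * y) ^+ n] is
    [x ^+ n * y ^+ n] for them, and the commuting pairs of [G] number
    [#|G| * #|classes G|]. Each vertex adds one more to the degree sum for its
    loop, so the equality says exactly that adjacent elements commute
    ([lcm_Deg_eqE]). What has to be shown is that this forces [G] to be abelian.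

    Two sources of adjacent pairs are enough. First, if [x], [y] and [x * y]
    have [p]-power orders, then [y] is adjacent to [x], or [x * y] to [x^-1],
    according to which of the products [x * y] and [y = x^-1 * (x * y)] has the
    smaller order ([p_elt_lcm_adj]); so every [p]-subgroup of [G] is abelian. Second, if [A]
    is abelian and [y] normalises [A], then for [x] in [A] the power
    [(x * y) ^+ #[y]] is a product of conjugates of [x] inside [A], so that
    [#[x * y]] divides [#[x] * #[y]] ([order_mul_norm_abelian]); this is the lcm
    when the two orders are coprime. Splitting an element of the normaliser
    of a Sylow [p]-subgroup [P] into its [p]-part and its [p']-part, the two
    facts together give ['N_G(P) \subset 'C(P)].

    This is the hypothesis of Burnside's transfer theorem. The transfer
    from [G] to [P] then sends [g] in [P] to [g ^+ #|G : P|], and is therefore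
    injective on [P]; since its target is abelian, [P] meets the derived
    subgroup trivially ([der1_TI_Sylow]). As this holds for every prime, the
    derived subgroup contains no element of prime order, hence is trivial. *)

Set Implicit Arguments.
Unset Strict Implicit.
Unset Printing Implicit Defensive.

Local Open Scope group_scope.

(** * Adjacency and commutation *)

(** The orbit-counting formula for conjugation, where the fixed points of [x]
    are its centraliser. *)
Lemma sum_card_cent1 (gT : finGroupType) (G : {group gT}) :
  (\sum_(x in G) #|'C_G[x]|)%N = (#|classes G| * #|G|)%N.
Proof.
have actsGG: [acts G, on G | 'J] by rewrite astabsJ normG.
have -> : classes G = orbit 'J G @: G by apply: eq_imset => x; rewrite orbitJ.
rewrite -(Frobenius_Cauchy actsGG); apply: eq_bigr => x _.
by rewrite afixJ cent_set1.
Qed.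

Lemma commute_lcm_adj (gT : finGroupType) (x y : gT) :
  commute x y -> lcm_adj x y.
Proof.
move=> cxy; rewrite /lcm_adj order_dvdn expgMn //.
have /eqP -> : x ^+ lcmn #[x] #[y] == 1 by rewrite -order_dvdn dvdn_lcml.
have /eqP -> : y ^+ lcmn #[x] #[y] == 1 by rewrite -order_dvdn dvdn_lcmr.
by rewrite mulg1.
Qed.

(** The centraliser of [x] is contained in the neighbourhood of [x], so the two
    sums of cardinals agree only if these sets agree for each [x]. *)
Lemma lcm_Deg_eqE (gT : finGroupType) (G : {group gT}) :
  lcm_Deg G = (#|G| * (#|classes G| + 1))%N <->
  {in G &, forall x y, lcm_adj x y -> commute x y}.
Proof.
have sCN x : 'C_G[x] \subset [set y in G | lcm_adj x y].
  apply/subsetP=> y /setIP[Gy /cent1P cxy].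
  by rewrite inE Gy; apply: commute_lcm_adj.
have DegE : lcm_Deg G = (#|G| + \sum_(x in G) #|[set y in G | lcm_adj x y]|)%N.
  rewrite -sum1_card -big_split; apply: eq_bigr => x _ /=.
  by rewrite lcm_degE.
have := leqif_sum (fun x (_ : x \in G) => subset_leqif_cards (sCN x)).
rewrite sum_card_cent1 => -[_ eqP_sum].
rewrite DegE addnC mulnDr muln1 (mulnC #|G|).
split=> [/addIn/esym/eqP | adjG].
  rewrite eqP_sum => /forall_inP eqCN x y Gx Gy adjxy.
  have: y \in 'C_G[x] by rewrite (eqP (eqCN x Gx)) inE Gy.
  by case/setIP=> _ /cent1P.
congr (_ + _)%N; apply/esym/eqP; rewrite eqP_sum.
apply/forall_inP=> x Gx; rewrite eqEsubset sCN; apply/subsetP=> y /setIdP[Gy].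
by move=> adjxy; apply/setIP; split=> //; apply/cent1P/commute_sym/adjG.
Qed.

(** * Adjacent pairs *)

(** Among prime powers divisibility is comparison: the first pair is
    adjacent unless the order of [x * y] exceeds that of [y], and then the
    product [y = x^-1 * (x * y)] of the second pair has order below that of
    [x * y]. *)
Lemma p_elt_lcm_adj (gT : finGroupType) (p : nat) (x y : gT) :
    p.-elt x -> p.-elt y -> p.-elt (x * y) ->
  lcm_adj x y \/ lcm_adj x^-1 (x * y).
Proof.
rewrite /lcm_adj mulKg orderV => /p_natP[a ->] /p_natP[b ->] /p_natP[c ->].
have dvdp i j k : (k <= i) || (k <= j) -> p ^ k %| lcmn (p ^ i) (p ^ j).
  by case/orP=> le_k; [apply: dvdn_trans (dvdn_lcml _ _)
    | apply: dvdn_trans (dvdn_lcmr _ _)]; apply: dvdn_exp2l.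
have [le_cb | /ltnW le_bc] := leqP c b.
  by left; rewrite dvdp // le_cb orbT.
by right; rewrite dvdp // le_bc orbT.
Qed.

(** Moving all factors [y] of [(x * y) ^+ n] to the right turns the factors [x]
    into conjugates of [x]. These lie in the elements of [A] killed by [#[x]],
    which form a subgroup since [A] is abelian. *)
Lemma order_mul_norm_abelian (gT : finGroupType) (A : {group gT}) (x y : gT) :
  abelian A -> x \in A -> y \in 'N(A) -> #[x * y] %| #[x] * #[y].
Proof.
move=> cAA Ax nAy; pose L := Group (group_Ldiv #[x] cAA).
have Lx : x \in L by apply/LdivP; rewrite expg_order.
have nLy : y \in 'N(L).
  rewrite inE; apply/subsetP=> _ /imsetP[z /LdivP[Az zx1] ->].
  by apply/LdivP; rewrite memJ_norm // -conjXg zx1 conj1g.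
have [u /LdivP[_ u1] xyE] :
    exists2 u, u \in L & (x * y) ^+ #[y] = u * y ^+ #[y].
  elim: #[y] => [|n [u Lu IHn]]; first by exists 1; rewrite ?mulg1.
  exists (x * u ^ y^-1); last by rewrite !expgS IHn conjgE invgK !mulgA mulgKV.
  by rewrite groupM // memJ_norm ?groupV.
by rewrite order_dvdn mulnC expgM xyE expg_order mulg1 u1.
Qed.

Lemma coprime_norm_lcm_adj (gT : finGroupType) (A : {group gT}) (x y : gT) :
    abelian A -> x \in A -> y \in 'N(A) -> coprime #[x] #[y] ->
  lcm_adj x y.
Proof.
move=> cAA Ax nAy co_xy; rewrite /lcm_adj.
have := muln_lcm_gcd #[x] #[y]; rewrite (eqnP co_xy) muln1 => ->.
exact: order_mul_norm_abelian nAy.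
Qed.

(** * Transfer to a Sylow subgroup centralised by its normaliser *)

(** Burnside's fusion argument: [P] and [P :^ x] are both Sylow subgroups of the
    centraliser of [g ^ x], hence conjugate there by some [c]; then [x * c]
    normalises [P], so it fixes [g], while [c] fixes [g ^ x]. *)
Lemma fusion_cent_norm_Sylow (gT : finGroupType) (p : nat)
    (G P : {group gT}) (g x : gT) :
    p.-Sylow(G) P -> 'N_G(P) \subset 'C(P) ->
  x \in G -> g \in P -> g ^ x \in P -> g ^ x = g.
Proof.
move=> sylP sNC Gx Pg Pgx; have sPG := pHall_sub sylP.
have cPP : abelian P by apply: subset_trans sNC; rewrite subsetI sPG normG.
pose C := 'C_G[g ^ x].
have sylC (Q : {group gT}) :
  p.-Sylow(G) Q -> abelian Q -> g ^ x \in Q -> p.-Sylow(C) Q.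
  move=> sylQ cQQ Qgx; have sQG := pHall_sub sylQ.
  apply: pHall_subl (subsetIl _ _) sylQ.
  by rewrite subsetI sQG (subset_trans cQQ) //= -cent_set1 centS ?sub1set.
have [c /setIP[Gc /cent1P cgx] defP] : exists2 c, c \in C & P :=: (P :^ x) :^ c.
  apply: Sylow_trans (sylC _ _ _ _) (sylC P sylP cPP Pgx).
  - by rewrite pHallJ.
  - by rewrite abelianJ.
  - by rewrite memJ_conjg.
have /(subsetP sNC)/centP/(_ g Pg) : x * c \in 'N_G(P).
  by rewrite inE groupM //= inE conjsgM -defP.
move=> cxcg; have : g ^ (x * c) = g by apply/conjg_fixP/commgP/commute_sym.
by rewrite conjgM (conjg_fixP _) //; apply/commgP.
Qed.

(** In the expansion of the transfer of [g] along the cosets of [P], each term is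
    a conjugate lying in [P] of a power of [g], hence equal to that power by
    [fusion_cent_norm_Sylow]; the exponents add up to [#|G : P|], which is prime to [#|P|]. *)
Lemma der1_TI_Sylow (gT : finGroupType) (p : nat) (G P : {group gT}) :
  p.-Sylow(G) P -> 'N_G(P) \subset 'C(P) -> P :&: G^`(1) = 1.
Proof.
move=> sylP sNC; have sPG := pHall_sub sylP.
have cPP : abelian (idm P @* P).
  by rewrite im_idm; apply: subset_trans sNC; rewrite subsetI sPG normG.
pose V := transfer_morphism G cPP.
apply/trivgP/subsetP=> g /setIP[Pg G'g]; have Gg := subsetP sPG g Pg.
(* The codomain of the transfer is the additive group of an abelian group. *)
have Vg0 : transfer G cPP g = 1.
  have /subsetP/(_ g G'g)/mker // : G^`(1) \subset 'ker V.
  rewrite der1_min ?ker_norm //.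
  rewrite (isog_abelian (first_isog V)).
  by apply/centsP=> u _ v _; apply: GRing.addrC.
have trX := transversalP (rcosets_cycle_partition sPG Gg).
set X := transversal _ _ in trX.
have sXG := subsetP (transversal_sub trX).
have := transfer_cycle_expansion sPG cPP Gg trX.
have fuse x : x \in X ->
    (g ^+ #|<[g]> : P :* x|) ^ x^-1 = g ^+ #|<[g]> : P :* x|.
  move=> /sXG Gx; apply: (fusion_cent_norm_Sylow sylP sNC).
  - by rewrite groupV.
  - by rewrite groupX.
  by rewrite conjgE invgK mulgA -mem_rcoset mulg_exp_card_rcosets.
have mPg : g \in idm P @* P by rewrite im_idm.
under eq_bigr => x Xx.
  rewrite fuse // /restrm /= FiniteModule.fmodX //.
  over.
rewrite Vg0 GRing.sumrMnr (sum_index_rcosets_cycle sPG Gg trX).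
rewrite -FiniteModule.fmodX // => /(congr1 val).
rewrite FiniteModule.fmodK ?groupX // => /esym gm1.
have co_m : coprime #|P| #|G : P|.
  by case/and3P: sylP => _ pP p'm; apply: pnat_coprime pP p'm.
by rewrite inE -(expgK co_m Pg) gm1 expg1n.
Qed.

(** * Groups in which adjacent elements commute *)

Lemma commuting_lcm_adj_pgroup_abelian (gT : finGroupType) (p : nat)
    (G P : {group gT}) :
    {in G &, forall x y, lcm_adj x y -> commute x y} ->
  P \subset G -> p.-group P -> abelian P.
Proof.
move=> adjG /subsetP sPG pP; apply/centsP=> x Px y Py.
have p_elt z : z \in P -> p.-elt z by apply: mem_p_elt.
have [] := p_elt_lcm_adj (p_elt x Px) (p_elt y Py) (p_elt _ (groupM Px Py)).
  by apply: adjG; apply: sPG.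
move/adjG; rewrite groupV => /(_ (sPG x Px) (sPG _ (groupM Px Py))).
move/commute_sym/commuteV/commute_sym; rewrite invgK => cxxy.
by rewrite -[y in commute x y](mulKg x); apply: commuteM => //; apply: commuteV.
Qed.

(** The [p]-part of an element normalising [P] lies in the abelian group [P],
    and its [p']-part is adjacent to all elements of [P]. *)
Lemma commuting_lcm_adj_cent_norm_Sylow (gT : finGroupType) (p : nat)
    (G P : {group gT}) :
    {in G &, forall x y, lcm_adj x y -> commute x y} ->
  p.-Sylow(G) P -> 'N_G(P) \subset 'C(P).
Proof.
move=> adjG sylP; have [sPG pP _] := and3P sylP.
have cPP := commuting_lcm_adj_pgroup_abelian adjG sPG pP.
have sylNP : p.-Sylow('N_G(P)) P.
  by apply: pHall_subl sylP; rewrite ?subsetIl // subsetI sPG normG.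
apply/subsetP=> y NGy; have [Gy NPy] := setIP NGy.
rewrite -(consttC p y) groupM //.
  rewrite (subsetP cPP) // (mem_normal_Hall sylNP) ?p_elt_constt //.
    by rewrite normalSG.
  by rewrite groupX.
apply/centP=> x Px; apply/commute_sym/adjG.
- exact: subsetP sPG x Px.
- by rewrite groupX.
apply: (coprime_norm_lcm_adj cPP Px); first by rewrite groupX.
exact: pnat_coprime (mem_p_elt pP Px) (p_elt_constt _ _).
Qed.

(** By Cauchy's theorem a nontrivial derived subgroup has an element of prime
    order; a Sylow subgroup containing it meets the derived subgroup
    nontrivially, against [der1_TI_Sylow]. *)
Lemma commuting_lcm_adj_abelian (gT : finGroupType) (G : {group gT}) :
  {in G &, forall x y, lcm_adj x y -> commute x y} -> abelian G.
Proof.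
move=> adjG; apply/commG1P/eqP; rewrite -[_ == 1]negbK trivg_card_le1 -ltnNge.
apply/negP=> /pdiv_prime p_pr; set p := pdiv _ in p_pr.
have [x G'x ox] := Cauchy p_pr (pdiv_dvd #|[~: G, G]|).
have sxG : <[x]> \subset G by rewrite cycle_subG (subsetP (der_sub 1 G)).
have [||P sylP sxP] := @Sylow_superset p _ G <[x]>%G => //.
  by rewrite /pgroup -orderE ox pnat_id.
have := der1_TI_Sylow sylP (commuting_lcm_adj_cent_norm_Sylow adjG sylP).
move/setP/(_ x); rewrite !inE derg1 G'x -cycle_subG sxP => /esym/eqP x1.
by move: p_pr; rewrite -ox x1 order1.
Qed.

Theorem theorem1p4 (gT : finGroupType) (G : {group gT}) :
  lcm_Deg G = (#|G| * (#|classes G| + 1))%N <-> abelian G.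
Proof.
split=> [/lcm_Deg_eqE|/centsP cGG]; first exact: commuting_lcm_adj_abelian.
by apply/lcm_Deg_eqE=> x y Gx Gy _; apply: cGG.
Qed.
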